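(* For $K>0$ let $y=y(t)$ be the solution, for $t\ge 0$, to the differential equation $$y'=\frac{(1-y)K}{y^2+(1-y^2)K}-1,\qquad y(0)=1,$$ and let $z=z(t)$ denote the solution to the differential equation $$z'=\frac{K}{y^2+(1-y^2)K}\,(z^2-1)+1,\qquad z(0)=1.$$ For every $K>0$ there exists a singularity point $t_c=t_c(K)>0$ such that $z(t)$ is continuous on $[0,t_c)$ and $\lim_{t\to t_c^-}z(t)=\infty$. Furthermore, there exists some constant $M>0$, independent of $K$, such that $t_c(K)\in(0,M)$ for every $K>0$.
   Context: All quantities are real; $K$ is a fixed real parameter, and primes denote derivatives with respect to $t$. *)

(* Defs.v *)
From Stdlib Require Import Reals.
From Coquelicot Require Import Coquelicot.
Open Scope R_scope.

Definition Ico (T : Rbar) (t : R) : Prop := 0 <= t /\ Rbar_lt t T.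

(** [x] solves [x' = f t x], [x 0 = x0] on [[0, T)].  The derivative is taken
    within [[0, T)], hence one-sided at [0].  [dom] is the set of [(t, x)] where
    the right-hand side is meaningful: division is total on [R], so the
    non-vanishing of denominators along a solution has to be required. *)
Definition ivp_solution (dom : R -> R -> Prop) (f : R -> R -> R) (x0 : R)
    (T : Rbar) (x : R -> R) : Prop :=
  x 0 = x0 /\
  forall t, Ico T t ->
    dom t (x t) /\ D_in x (fun s => f s (x s)) (Ico T) t.

(** "The" solution of the initial value problem, with [[0, T)] as its maximal
    interval of existence to the right of [0]; it extends every other solution.
    The values of [x] outside [[0, T)] are irrelevant. *)
Definition ivp_max_solution (dom : R -> R -> Prop) (f : R -> R -> R) (x0 : R)
    (T : Rbar) (x : R -> R) : Prop :=
  Rbar_lt 0 T /\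
  ivp_solution dom f x0 T x /\
  forall (S : Rbar) (w : R -> R), ivp_solution dom f x0 S w ->
    Rbar_le S T /\ forall t, Ico S t -> w t = x t.

Definition den (K y : R) : R := y ^ 2 + (1 - y ^ 2) * K.

Definition is_y (K : R) (T : Rbar) (y : R -> R) : Prop :=
  ivp_max_solution (fun _ y => den K y <> 0)
    (fun _ y => (1 - y) * K / den K y - 1) 1 T y.

Definition is_z (K : R) (y : R -> R) (T : Rbar) (z : R -> R) : Prop :=
  ivp_max_solution (fun t _ => den K (y t) <> 0)
    (fun t z => K / den K (y t) * (z ^ 2 - 1) + 1) 1 T z.

(* Main.v *)
Require Import Defs.
From Stdlib Require Import Reals Lra IndefiniteDescription.
From Coquelicot Require Import Coquelicot.
Open Scope R_scope.

(** The first equation can be rewritten as [y' = - y (y + K (1 - y)) / den K y].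
    Its right-hand side vanishes at [0] and is negative on [(0, 1]], so [y]
    decreases and stays in [[0, 1]], where [den] is positive; [y] exists for all
    times.

    With [a = K / den K y > 0] the second equation is the Riccati equation
    [z' = a (z ^ 2 - 1) + 1].  The substitution [z = tan th] turns it into
    [th' = 1 / 2 + (1 / 2 - a) cos (2 th)] with [th 0 = PI / 4], whose right-hand
    side is bounded and Lipschitz in [th], so that blow-up of [z] becomes
    the passage of [th] through [PI / 2].  For [th] between [PI / 4] and [PI / 2]
    the cosine is nonpositive and [th] increases strictly; [tc] is the time when
    it reaches [PI / 2].

    The uniform bound on [tc] rests on [y_square_small]: whatever [K], after time
    [2] one has [y ^ 2 <= K], hence [den <= 2 K] and [a >= 1 / 2].  From then on
    [th' >= 1 / 2], so that [th] exceeds [PI / 2] before time [5]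
    ([angle_reaches_PI2]).

    Both solutions are obtained from a global Picard theorem ([picard_global]),
    after truncating the unknown to the interval where it is going to live.
    Uniqueness among all solutions, which are not known in advance to stay in
    these intervals, comes from [ivp_unique]: the difference [d] of two solutions
    satisfies [d' = g d] with [g] continuous.  Maximality of [z] on [[0, tc)] is
    then a consequence of its divergence ([blowup_maximal]). *)

(** * Mean value estimates *)

Lemma mean_growth (f df : R -> R) (a b m : R) :
  a <= b ->
  (forall t, a <= t <= b -> continuity_pt f t) ->
  (forall t, a < t < b -> is_derive f t (df t)) ->
  (forall t, a <= t <= b -> m <= df t) ->
  m * (b - a) <= f b - f a.
Proof.
intros Hab Hc Hd Hm.
destruct (MVT_gen f a b df) as [c [Hc1 Hc2]];
  rewrite ?Rmin_left, ?Rmax_right in * by lra; auto.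
rewrite Hc2; apply Rmult_le_compat_r; [lra | now apply Hm].
Qed.

Lemma is_derive_continuity_pt (f : R -> R) (t l : R) :
  is_derive f t l -> continuity_pt f t.
Proof.
intros H; apply derivable_continuous_pt; exists l.
now apply is_derive_Reals.
Qed.

Lemma dominated_increment (p dp h dh : R -> R) (a b : R) :
  a <= b ->
  (forall t, a <= t <= b -> is_derive p t (dp t)) ->
  (forall t, a <= t <= b -> is_derive h t (dh t)) ->
  (forall t, a <= t <= b -> Rabs (dp t) <= dh t) ->
  Rabs (p b - p a) <= h b - h a.
Proof.
intros Hab Hp Hh Hle.
assert (H1 : forall t, a <= t <= b ->
    is_derive (fun s => h s - p s) t (dh t - dp t)).
{ intros t Ht; exact (is_derive_minus _ _ _ _ _ (Hh t Ht) (Hp t Ht)). }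
assert (H2 : forall t, a <= t <= b ->
    is_derive (fun s => h s + p s) t (dh t + dp t)).
{ intros t Ht; exact (is_derive_plus _ _ _ _ _ (Hh t Ht) (Hp t Ht)). }
assert (G1 := mean_growth _ _ a b 0 Hab
  (fun t Ht => is_derive_continuity_pt _ _ _ (H1 t Ht))
  (fun t Ht => H1 t (conj (Rlt_le _ _ (proj1 Ht)) (Rlt_le _ _ (proj2 Ht))))).
assert (G2 := mean_growth _ _ a b 0 Hab
  (fun t Ht => is_derive_continuity_pt _ _ _ (H2 t Ht))
  (fun t Ht => H2 t (conj (Rlt_le _ _ (proj1 Ht)) (Rlt_le _ _ (proj2 Ht))))).
assert (K1 : forall t, a <= t <= b -> 0 <= dh t - dp t).
{ intros t Ht; specialize (Hle t Ht); apply Rabs_le_between in Hle; lra. }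
assert (K2 : forall t, a <= t <= b -> 0 <= dh t + dp t).
{ intros t Ht; specialize (Hle t Ht); apply Rabs_le_between in Hle; lra. }
specialize (G1 K1); specialize (G2 K2); simpl in G1, G2.
apply Rabs_le_between; lra.
Qed.

(** * Global existence for bounded Lipschitz equations *)

Lemma is_derive_primitive (g : R -> R) (c t : R) :
  (forall s, continuous g s) ->
  is_derive (fun u => c + RInt g 0 u) t (g t).
Proof.
intros Hg.
replace (g t) with (plus zero (g t)) by apply plus_zero_l.
apply (is_derive_plus (fun _ => c)); [exact (is_derive_const c t)|].
apply (is_derive_RInt g (fun u => RInt g 0 u) 0); auto.
apply filter_forall; intros u.
apply (RInt_correct (V := R_CompleteNormedModule)).
apply (ex_RInt_continuous (V := R_CompleteNormedModule)); auto.
Qed.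

Lemma lipschitz_continuous (x : R -> R) (B : R) :
  (forall t s, Rabs (x t - x s) <= B * Rabs (t - s)) ->
  forall t, continuous x t.
Proof.
intros H t; apply continuity_pt_filterlim.
assert (HB : 0 <= B).
{ specialize (H 1 0). rewrite (Rminus_0_r 1), Rabs_R1 in H.
  assert (Hp := Rabs_pos (x 1 - x 0)); lra. }
intros e He; exists (e / (B + 1)); split; [apply Rdiv_lt_0_compat; lra|].
intros s [_ Hs]; simpl in *; unfold R_dist in *.
apply Rle_lt_trans with (1 := H s t).
assert (Rabs (s - t) * (B + 1) < e).
{ apply (Rmult_lt_compat_r (B + 1)) in Hs; [|lra].
  unfold Rdiv in Hs; rewrite Rmult_assoc, Rinv_l in Hs; lra. }
assert (Hp := Rabs_pos (s - t)); lra.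
Qed.

Lemma Rmax_lipschitz (c t s : R) :
  Rabs (Rmax c t - Rmax c s) <= Rabs (t - s).
Proof.
unfold Rmax; repeat destruct Rle_dec; unfold Rabs; repeat destruct Rcase_abs;
  lra.
Qed.

Fixpoint picard_iterate (f : R -> R -> R) (x0 : R) (n : nat) (t : R) : R :=
  match n with
  | O => x0
  | S m => x0 + RInt (fun s => f s (picard_iterate f x0 m s)) 0 t
  end.

(** Continuity is required along curves rather than jointly in both variables:
    in this form it makes every Picard integrand integrable at once, and it
    follows from composition when [f] is built from one-variable functions. *)
Definition superposition_continuous (f : R -> R -> R) : Prop :=
  forall x : R -> R, (forall t, continuous x t) ->
  forall t, continuous (fun s => f s (x s)) t.

Lemma picard_iterate_continuous (f : R -> R -> R) (x0 : R) (n : nat) :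
  superposition_continuous f -> forall t, continuous (picard_iterate f x0 n) t.
Proof.
intros Hf; induction n as [|n IH]; intros t.
- apply continuous_const.
- apply (ex_derive_continuous (K := R_AbsRing) (V := R_NormedModule)).
  eexists; apply (is_derive_primitive
    (fun s => f s (picard_iterate f x0 n s))).
  now apply Hf.
Qed.

Lemma picard_iterate_derive (f : R -> R -> R) (x0 : R) (n : nat) (t : R) :
  superposition_continuous f ->
  is_derive (picard_iterate f x0 (S n)) t (f t (picard_iterate f x0 n t)).
Proof.
intros Hf.
apply (is_derive_primitive (fun s => f s (picard_iterate f x0 n s))).
now apply Hf, picard_iterate_continuous.
Qed.

Lemma picard_iterate_0 (f : R -> R -> R) (x0 : R) (n : nat) :
  picard_iterate f x0 n 0 = x0.
Proof. destruct n; simpl; auto. rewrite RInt_point. unfold zero; simpl; lra. Qed.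

Lemma picard_iterate_lipschitz (f : R -> R -> R) (x0 B : R) (n : nat) :
  superposition_continuous f -> (forall t x, Rabs (f t x) <= B) ->
  forall t s,
  Rabs (picard_iterate f x0 n t - picard_iterate f x0 n s) <= B * Rabs (t - s).
Proof.
intros Hf HB t s; destruct n as [|n].
- simpl; rewrite Rminus_diag, Rabs_R0; apply Rmult_le_pos; [|apply Rabs_pos].
  apply Rle_trans with (2 := HB 0 0), Rabs_pos.
- apply (bounded_variation _ (fun t => f t (picard_iterate f x0 n t))).
  intros u _; split; auto; now apply picard_iterate_derive.
Qed.

(** Bielecki's weight.  Its growth rate is twice the Lipschitz constant [L], so
    that integration halves weighted distances on the whole half-line, whatever
    its length; the factor in front makes the first step at most the weight. *)
Definition weight (B L t : R) : R := B / (2 * L) * exp (2 * L * t).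

Lemma weight_derive (B L c t : R) : L <> 0 ->
  is_derive (fun s => weight B L s * c) t (2 * L * (weight B L t * c)).
Proof. intros HL; unfold weight; auto_derive; auto; field; auto. Qed.

Lemma weight_pos (B L t : R) : 0 < L -> 0 <= B -> 0 <= weight B L t.
Proof.
intros HL HB; apply Rmult_le_pos; [|apply Rlt_le, exp_pos].
apply Rmult_le_pos; auto; apply Rlt_le, Rinv_0_lt_compat; lra.
Qed.

Lemma half_pow_pos (n : nat) : 0 < (/ 2) ^ n.
Proof. apply pow_lt; lra. Qed.

(** The contraction: the integrals of [f] along two curves at weighted distance
    [c] are at weighted distance [c / 2], because the Lipschitz bound [L] is half
    the logarithmic derivative of the weight. *)
Lemma picard_integral_gap (f : R -> R -> R) (L B c : R) (X X' x x' : R -> R) :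
  0 < L -> 0 <= B -> 0 <= c ->
  (forall t u v, Rabs (f t u - f t v) <= L * Rabs (u - v)) ->
  X 0 = X' 0 ->
  (forall t, is_derive X t (f t (x t))) ->
  (forall t, is_derive X' t (f t (x' t))) ->
  (forall t, 0 <= t -> Rabs (x t - x' t) <= weight B L t * c) ->
  forall t, 0 <= t -> Rabs (X t - X' t) <= weight B L t * (c * / 2).
Proof.
intros HL HB Hc Hf H0 HX HX' Hx t Ht.
assert (H := dominated_increment (fun s => X s - X' s)
  (fun s => f s (x s) - f s (x' s))
  (fun s => weight B L s * (c * / 2))
  (fun s => 2 * L * (weight B L s * (c * / 2))) 0 t Ht).
simpl in H; rewrite H0, Rminus_diag, Rminus_0_r in H.
assert (Hw : 0 <= weight B L 0 * (c * / 2)).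
{ apply Rmult_le_pos; [now apply weight_pos | lra]. }
apply Rle_trans with (weight B L t * (c * / 2) - weight B L 0 * (c * / 2));
  [apply H|lra].
- intros s _; exact (is_derive_minus _ _ _ _ _ (HX s) (HX' s)).
- intros s _; apply weight_derive; lra.
- intros s Hs; apply Rle_trans with (1 := Hf _ _ _).
  replace (2 * L * (weight B L s * (c * / 2)))
    with (L * (weight B L s * c)) by field.
  apply Rmult_le_compat_l; [lra | apply Hx; lra].
Qed.

Lemma picard_iterate_step (f : R -> R -> R) (x0 L B : R) (n : nat) :
  0 < L -> superposition_continuous f ->
  (forall t x, Rabs (f t x) <= B) ->
  (forall t u v, Rabs (f t u - f t v) <= L * Rabs (u - v)) ->
  forall t, 0 <= t ->
  Rabs (picard_iterate f x0 (S n) t - picard_iterate f x0 n t)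
    <= weight B L t * (/ 2) ^ n.
Proof.
intros HL Hc HB Hf.
assert (HB0 : 0 <= B) by (apply Rle_trans with (2 := HB 0 0), Rabs_pos).
induction n as [|n IH]; intros t Ht.
- replace (picard_iterate f x0 0 t) with (picard_iterate f x0 1 0)
    by apply picard_iterate_0.
  apply Rle_trans with (1 := picard_iterate_lipschitz f x0 B 1 Hc HB t 0).
  rewrite Rminus_0_r, Rabs_pos_eq by auto; unfold weight; simpl pow.
  replace (B / (2 * L) * exp (2 * L * t) * 1)
    with (B * (/ (2 * L) * exp (2 * L * t))) by (field; lra).
  apply Rmult_le_compat_l; auto.
  replace t with (/ (2 * L) * (2 * L * t)) at 1 by (field; lra).
  apply Rmult_le_compat_l; [apply Rlt_le, Rinv_0_lt_compat; lra|].
  assert (He := exp_ineq1_le (2 * L * t)); lra.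
- replace ((/ 2) ^ S n) with ((/ 2) ^ n * / 2) by (simpl; ring).
  apply (picard_integral_gap f L B ((/ 2) ^ n) _ _
    (picard_iterate f x0 (S n)) (picard_iterate f x0 n)); auto.
  + apply Rlt_le, half_pow_pos.
  + now rewrite !picard_iterate_0.
  + intros s; now apply picard_iterate_derive.
  + intros s; now apply picard_iterate_derive.
Qed.

Lemma geometric_steps_limit (u : nat -> R) (w : R) :
  (forall n, Rabs (u (S n) - u n) <= w * (/ 2) ^ n) ->
  exists l, is_lim_seq u (Finite l) /\
    forall n, Rabs (u n - l) <= w * (2 * (/ 2) ^ n).
Proof.
intros H.
assert (Hw : 0 <= w).
{ specialize (H O); simpl in H; assert (H0 := Rabs_pos (u 1%nat - u O)); lra. }
assert (Hk : forall n k,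
    Rabs (u (n + k)%nat - u n) <= w * (2 * (/ 2) ^ n - 2 * (/ 2) ^ (n + k))).
{ intros n; induction k as [|k IH].
  - rewrite Nat.add_0_r, !Rminus_diag, Rabs_R0; lra.
  - rewrite Nat.add_succ_r; specialize (H (n + k)%nat).
    replace (u (S (n + k)) - u n)
      with ((u (S (n + k)) - u (n + k)%nat) + (u (n + k)%nat - u n)) by ring.
    apply Rle_trans with (1 := Rabs_triang _ _); simpl; lra. }
assert (Hk' : forall n k, Rabs (u (n + k)%nat - u n) <= w * (2 * (/ 2) ^ n)).
{ intros n k; apply Rle_trans with (1 := Hk n k), Rmult_le_compat_l; auto.
  assert (H0 := half_pow_pos (n + k)); lra. }
assert (Hz : is_lim_seq (fun n => w * (2 * (/ 2) ^ n)) 0).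
{ replace (Finite 0) with (Rbar_mult w (Rbar_mult 2 0))
    by (simpl; f_equal; ring).
  apply is_lim_seq_scal_l, is_lim_seq_scal_l, is_lim_seq_geom.
  rewrite Rabs_pos_eq; lra. }
assert (Hex : ex_finite_lim_seq u).
{ apply ex_lim_seq_cauchy_corr; intros e.
  apply is_lim_seq_spec in Hz.
  assert (He : 0 < e / 2) by (destruct e; simpl; lra).
  destruct (Hz (mkposreal _ He)) as [N HN]; exists N.
  specialize (HN N (Nat.le_refl N)); simpl in HN.
  rewrite Rminus_0_r in HN; apply Rabs_lt_between in HN.
  intros n m Hn Hm.
  assert (H1 := Hk' N (n - N)%nat); assert (H2 := Hk' N (m - N)%nat).
  replace (N + (n - N))%nat with n in H1
    by (rewrite Nat.add_comm; symmetry; now apply Nat.sub_add).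
  replace (N + (m - N))%nat with m in H2
    by (rewrite Nat.add_comm; symmetry; now apply Nat.sub_add).
  apply Rabs_le_between in H1; apply Rabs_le_between in H2.
  apply Rabs_lt_between; lra. }
destruct Hex as [l Hl]; exists l; split; auto.
intros n.
assert (Hl' : is_lim_seq (fun k => Rabs (u (n + k)%nat - u n))
                (Rbar_abs (Finite (l - u n)))).
{ apply is_lim_seq_abs, is_lim_seq_minus'; [|apply is_lim_seq_const].
  apply is_lim_seq_ext with (fun k => u (k + n)%nat);
    [intros k; now rewrite Nat.add_comm|].
  now apply is_lim_seq_incr_n. }
assert (Hfin := is_lim_seq_le _ _ _ _ (Hk' n) Hl' (is_lim_seq_const _)).
simpl in Hfin; now rewrite Rabs_minus_sym.
Qed.

(** The iterates converge pointwise on the half-line [t >= 0] by contraction.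
    All of them are [B]-Lipschitz, hence so is the limit, and a second use of
    the contraction shows that the limit solves the integral equation. *)
Theorem picard_global (f : R -> R -> R) (x0 L B : R) :
  0 < L -> superposition_continuous f ->
  (forall t x, Rabs (f t x) <= B) ->
  (forall t u v, Rabs (f t u - f t v) <= L * Rabs (u - v)) ->
  exists x : R -> R, x 0 = x0 /\ (forall t, continuous x t) /\
    forall t, 0 <= t -> is_derive x t (f t (x t)).
Proof.
intros HL Hc HB Hf.
assert (HB0 : 0 <= B) by (apply Rle_trans with (2 := HB 0 0), Rabs_pos).
set (X := picard_iterate f x0).
destruct (functional_choice (fun t l => 0 <= t ->
    is_lim_seq (fun n => X n t) (Finite l) /\
    forall n, Rabs (X n t - l) <= weight B L t * (2 * (/ 2) ^ n)))
  as [l Hl].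
{ intros t; destruct (Rle_dec 0 t) as [Ht|Ht].
  - destruct (geometric_steps_limit (fun n => X n t) (weight B L t)) as [l Hl].
    + intros n; now apply picard_iterate_step.
    + now exists l.
  - exists 0; intros; contradiction. }
(* Convergence is only known for [t >= 0]; freezing the limit at time [0]
   keeps it continuous on the whole line. *)
set (x := fun t => l (Rmax 0 t)).
assert (Hx : forall t, continuous x t).
{ apply lipschitz_continuous with B; intros t s.
  assert (H : Rabs (x t - x s) <= B * Rabs (Rmax 0 t - Rmax 0 s)).
  { destruct (Hl _ (Rmax_l 0 t)) as [Ht _]; destruct (Hl _ (Rmax_l 0 s)) as [Hs _].
    refine (is_lim_seq_le _ _ (Rbar_abs (Finite (x t - x s))) _
      (fun n => picard_iterate_lipschitz f x0 B n Hc HB _ _) _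
      (is_lim_seq_const _)).
    now apply is_lim_seq_abs, is_lim_seq_minus'. }
  apply Rle_trans with (1 := H), Rmult_le_compat_l; auto.
  apply Rmax_lipschitz. }
set (Y := fun t => x0 + RInt (fun s => f s (x s)) 0 t).
assert (HY : forall t, is_derive Y t (f t (x t))).
{ intros t; apply (is_derive_primitive (fun s => f s (x s))); now apply Hc. }
assert (HYx : forall t, 0 <= t -> Y t = x t).
{ intros t Ht; unfold x; rewrite Rmax_right by auto.
  destruct (Hl t Ht) as [Hlim _].
  assert (HlimY : is_lim_seq (fun n => X (S n) t) (Finite (Y t))).
  { apply is_lim_seq_ext with (fun n => Y t - (Y t - X (S n) t));
      [intros n; ring|].
    replace (Finite (Y t)) with (Finite (Y t - 0)) by (f_equal; ring).
    apply is_lim_seq_minus'; [apply is_lim_seq_const|].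
    apply is_lim_seq_abs_0.
    apply is_lim_seq_le_le with (fun _ => 0) (fun n => weight B L t * (/ 2) ^ n).
    - intros n; split; [apply Rabs_pos|].
      rewrite Rabs_minus_sym.
      replace ((/ 2) ^ n) with (2 * (/ 2) ^ n * / 2) by field.
      apply (picard_integral_gap f L B (2 * (/ 2) ^ n) _ _ (X n) x); auto.
      + assert (H := half_pow_pos n); lra.
      + unfold Y, X; rewrite picard_iterate_0, RInt_point; unfold zero; simpl; lra.
      + intros s; now apply picard_iterate_derive.
      + intros s Hs; unfold x; rewrite Rmax_right by auto; now apply Hl.
    - apply is_lim_seq_const.
    - replace (Finite 0) with (Rbar_mult (weight B L t) 0)
        by (simpl; f_equal; ring).
      apply is_lim_seq_scal_l, is_lim_seq_geom; rewrite Rabs_pos_eq; lra. }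
  apply is_lim_seq_incr_1 in Hlim.
  apply is_lim_seq_unique in Hlim; apply is_lim_seq_unique in HlimY.
  rewrite Hlim in HlimY; now injection HlimY. }
exists Y; split; [|split].
- unfold Y; rewrite RInt_point; unfold zero; simpl; lra.
- intros t; apply (ex_derive_continuous (K := R_AbsRing) (V := R_NormedModule)).
  eexists; apply HY.
- intros t Ht; rewrite HYx by auto; apply HY.
Qed.

(** * Uniqueness and maximality *)

(** Gronwall: if [C] bounds [g] on [[0, b]] then [d ^ 2 * exp (- 2 C t)] is
    nonincreasing, nonnegative, and zero at [0]. *)
Lemma linear_ode_zero (d g : R -> R) (b : R) :
  0 <= b ->
  (forall t, 0 <= t <= b -> continuity_pt d t) ->
  (forall t, 0 <= t <= b -> continuity_pt g t) ->
  (forall t, 0 < t < b -> is_derive d t (g t * d t)) ->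
  d 0 = 0 -> d b = 0.
Proof.
intros Hb Hd Hg Hder H0.
destruct (continuity_ab_maj g 0 b Hb Hg) as [tm [Hm _]].
set (C := g tm) in Hm.
set (phi := fun t => - ((d t) ^ 2 * exp (- 2 * C * t))).
assert (Hphi : 0 * (b - 0) <= phi b - phi 0).
{ apply (mean_growth phi
    (fun t => 2 * (C - g t) * (d t) ^ 2 * exp (- 2 * C * t))); auto.
  - intros t Ht; unfold phi.
    apply (continuity_pt_opp (fun t => d t ^ 2 * exp (-2 * C * t))).
    apply (continuity_pt_mult (fun t => d t ^ 2) (fun t => exp (-2 * C * t))).
    + apply (continuity_pt_comp d (fun v => v ^ 2)); auto.
      apply derivable_continuous_pt, derivable_pt_pow.
    + apply (is_derive_continuity_pt _ _ (-2 * C * exp (-2 * C * t))).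
      auto_derive; auto; ring.
  - intros t Ht; unfold phi.
    assert (H1 := Hder t Ht).
    auto_derive; [now exists (g t * d t)|].
    rewrite (is_derive_unique (fun x : R => d x) t _ H1); ring.
  - intros t Ht; specialize (Hm t Ht).
    apply Rmult_le_pos; [|apply Rlt_le, exp_pos].
    apply Rmult_le_pos; [lra|apply pow2_ge_0]. }
unfold phi in Hphi; rewrite H0 in Hphi.
assert (Hp := exp_pos (-2 * C * b)).
assert (Hs := pow2_ge_0 (d b)).
assert (Hz : d b ^ 2 = 0) by nra.
nra.
Qed.

Lemma Rbar_lt_open (t : R) (T : Rbar) :
  Rbar_lt t T -> exists r : R, 0 < r /\ forall s, s < t + r -> Rbar_lt s T.
Proof.
destruct T as [T| |]; simpl; intros H.
- exists (T - t); split; [lra | intros s Hs; lra].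
- exists 1; split; [lra | auto].
- contradiction.
Qed.

Lemma ivp_derive (dom : R -> R -> Prop) (f : R -> R -> R) (x0 : R) (T : Rbar)
    (x : R -> R) (t : R) :
  ivp_solution dom f x0 T x -> 0 < t -> Rbar_lt t T ->
  is_derive x t (f t (x t)).
Proof.
intros [_ Hx] Ht HT.
destruct (Hx t (conj (Rlt_le _ _ Ht) HT)) as [_ HD].
destruct (Rbar_lt_open t T HT) as [r [Hr Hr']].
apply is_derive_Reals; intros e He.
destruct (HD e He) as [al [Hal Hlim]]; simpl in Hlim; unfold R_dist in Hlim.
assert (Hm : 0 < Rmin al (Rmin r t)) by (repeat apply Rmin_pos; lra).
exists (mkposreal _ Hm); simpl; intros h Hh Hlt.
assert (H1 := Rmin_l al (Rmin r t)); assert (H2 := Rmin_r al (Rmin r t)).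
assert (H3 := Rmin_l r t); assert (H4 := Rmin_r r t).
assert (Hh' := Hlt); apply Rabs_lt_between in Hh'.
specialize (Hlim (t + h)).
replace (t + h - t) with h in Hlim by ring.
apply Hlim; split; [|lra].
split; [split; [lra | apply Hr'; lra] | lra].
Qed.

(** Freezing a solution at its initial value for negative times turns its
    one-sided continuity at [0] into two-sided continuity, the form in which the
    theorems on compact intervals are available. *)
Lemma ivp_continuous (dom : R -> R -> Prop) (f : R -> R -> R) (x0 : R)
    (T : Rbar) (x : R -> R) (t : R) :
  ivp_solution dom f x0 T x -> Ico T t ->
  continuity_pt (fun s => x (Rmax 0 s)) t.
Proof.
intros [_ Hx] [Ht HT].
destruct (Hx t (conj Ht HT)) as [_ HD].
destruct (Rbar_lt_open t T HT) as [r [Hr Hr']].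
apply cont_deriv in HD.
intros e He; destruct (HD e He) as [al [Hal Hlim]].
exists (Rmin al r); split; [now apply Rmin_pos|].
simpl in *; unfold R_dist in *; intros s [_ Hs].
assert (H1 := Rmin_l al r); assert (H2 := Rmin_r al r).
rewrite (Rmax_right 0 t) by auto.
destruct (Req_dec (Rmax 0 s) t) as [Heq|Hne].
- rewrite Heq, Rminus_diag, Rabs_R0; lra.
- apply Rabs_lt_between in Hs.
  apply Hlim; split; [split; [split; [apply Rmax_l|]|auto]|].
  + apply Hr'; unfold Rmax; destruct Rle_dec; lra.
  + apply Rabs_lt_between; unfold Rmax in *; destruct Rle_dec; lra.
Qed.

(** A factorisation of the difference of the right-hand sides, with a factor
    continuous along the two solutions, replaces a local Lipschitz condition:
    the difference of the solutions then solves a homogeneous linear equation. *)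
Lemma ivp_unique (dom : R -> R -> Prop) (f : R -> R -> R) (x0 : R)
    (S T : Rbar) (w x g : R -> R) :
  ivp_solution dom f x0 S w -> ivp_solution dom f x0 T x ->
  (forall t, Ico S t -> Ico T t ->
     f t (w t) - f t (x t) = g t * (w t - x t)) ->
  (forall t, Ico S t -> Ico T t -> continuity_pt (fun s => g (Rmax 0 s)) t) ->
  forall t, Ico S t -> Ico T t -> w t = x t.
Proof.
intros Hw Hx Hg Hgc b HbS HbT.
assert (Hin : forall U t, Ico U b -> 0 <= t <= b -> Ico U t).
{ intros U t [_ HU] Ht; split; [lra|].
  apply Rbar_le_lt_trans with b; [simpl; lra | auto]. }
assert (Hz := linear_ode_zero (fun s => w (Rmax 0 s) - x (Rmax 0 s))
  (fun s => g (Rmax 0 s)) b (proj1 HbS)).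
simpl in Hz; rewrite (Rmax_right 0 b) in Hz by apply HbS.
apply Rminus_diag_uniq, Hz; clear Hz.
- intros t Ht.
  apply (continuity_pt_minus (fun s => w (Rmax 0 s)) (fun s => x (Rmax 0 s)));
    eapply ivp_continuous; eauto.
- intros t Ht; apply Hgc; auto.
- intros t Ht.
  assert (HtS : Ico S t) by (apply Hin; [auto|lra]).
  assert (HtT : Ico T t) by (apply Hin; [auto|lra]).
  rewrite !(Rmax_right 0 t) by lra; rewrite <- Hg by auto.
  apply is_derive_ext_loc with (fun s => w s - x s).
  + exists (mkposreal t (proj1 Ht)); intros s Hs.
    apply Rabs_lt_between in Hs; simpl in Hs.
    unfold minus, plus, opp in Hs; simpl in Hs.
    now rewrite Rmax_right by lra.
  + refine (is_derive_minus w x t _ _ _ _);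
      [apply (ivp_derive _ _ _ _ _ t Hw) | apply (ivp_derive _ _ _ _ _ t Hx)];
      try apply HtS; try apply HtT; lra.
- rewrite Rmax_left by lra; rewrite (proj1 Hw), (proj1 Hx); ring.
Qed.

Lemma ivp_solution_of_derive (dom : R -> R -> Prop) (f : R -> R -> R) (x0 : R)
    (T : Rbar) (x : R -> R) :
  x 0 = x0 ->
  (forall t, Ico T t -> dom t (x t) /\ is_derive x t (f t (x t))) ->
  ivp_solution dom f x0 T x.
Proof.
intros H0 H; split; auto; intros t Ht; split; [now apply H|].
apply D_in_imp with no_cond; [now unfold no_cond|].
apply derivable_pt_lim_D_in, is_derive_Reals, H, Ht.
Qed.

(** A solution continued up to [tc] would be bounded near [tc], yet agree there
    with the divergent [z]. *)
Lemma blowup_maximal (S : Rbar) (tc : R) (w z : R -> R) :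
  0 < tc ->
  (forall t, Ico S t -> continuity_pt (fun s => w (Rmax 0 s)) t) ->
  filterlim z (at_left tc) (Rbar_locally p_infty) ->
  (forall t, Ico S t -> Ico tc t -> w t = z t) ->
  Rbar_le S tc.
Proof.
intros Htc Hc Hz Heq.
apply Rbar_not_lt_le; intros HS.
assert (HtcS : Ico S tc) by (split; [lra|auto]).
destruct (Hc tc HtcS 1 Rlt_0_1) as [al [Hal Hw]].
simpl in Hw; unfold R_dist in Hw; rewrite (Rmax_right 0 tc) in Hw by lra.
assert (Hbig : at_left tc (fun t => w tc + 1 < z t)).
{ apply Hz; exists (w tc + 1); auto. }
destruct Hbig as [e He].
set (r := Rmin e (Rmin al tc)).
assert (Hr : 0 < r) by (repeat apply Rmin_pos; try lra; apply cond_pos).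
assert (Hr1 : r <= e) by apply Rmin_l.
assert (Hr2 : r <= Rmin al tc) by apply Rmin_r.
assert (Hr3 := Rmin_l al tc); assert (Hr4 := Rmin_r al tc).
set (s := tc - r / 2).
assert (Hzs : w tc + 1 < z s).
{ apply He; [|unfold s; lra].
  unfold ball; simpl; unfold AbsRing_ball, abs, minus, plus, opp; simpl.
  apply Rabs_lt_between; unfold s; lra. }
assert (Hws : Rabs (w s - w tc) < 1).
{ replace (w s) with (w (Rmax 0 s))
    by (rewrite Rmax_right; [auto | unfold s; lra]).
  apply Hw; split; [split; [exact I | unfold s; lra]|].
  apply Rabs_lt_between; unfold s; lra. }
rewrite Heq in Hws.
- apply Rabs_lt_between in Hws; lra.
- split; [unfold s; lra|].
  apply Rbar_lt_trans with tc; [unfold s; simpl; lra | auto].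
- split; unfold s; simpl; lra.
Qed.

(** * The equation for y *)

Definition clamp (a b x : R) : R := Rmax a (Rmin b x).

Lemma clamp_in (a b x : R) : a <= b -> a <= clamp a b x <= b.
Proof. unfold clamp, Rmax, Rmin; intros; repeat destruct Rle_dec; lra. Qed.

Lemma clamp_id (a b x : R) : a <= x <= b -> clamp a b x = x.
Proof. unfold clamp, Rmax, Rmin; intros; repeat destruct Rle_dec; lra. Qed.

Lemma clamp_lipschitz (a b x y : R) :
  Rabs (clamp a b x - clamp a b y) <= 1 * Rabs (x - y).
Proof.
unfold clamp, Rmax, Rmin; repeat destruct Rle_dec;
  unfold Rabs; repeat destruct Rcase_abs; lra.
Qed.

Lemma clamp_continuous (a b x : R) : continuous (clamp a b) x.
Proof. exact (lipschitz_continuous _ 1 (clamp_lipschitz a b) x). Qed.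

Definition y_field (K y : R) : R := (1 - y) * K / den K y - 1.

Lemma den_lower (K c : R) : 0 < K -> 0 <= c <= 1 -> Rmin 1 K <= den K c.
Proof.
intros HK Hc; unfold den, Rmin; assert (0 <= c ^ 2 <= 1) by nra.
destruct Rle_dec; nra.
Qed.

Lemma den_pos (K c : R) : 0 < K -> 0 <= c <= 1 -> 0 < den K c.
Proof.
intros HK Hc; apply Rlt_le_trans with (2 := den_lower K c HK Hc).
apply Rmin_pos; lra.
Qed.

(** The difference quotient of [y_field] between [u] and [v].  Having it as a
    rational function serves twice: it bounds the Lipschitz constant on [[0, 1]],
    and it is the linear coefficient needed for uniqueness. *)
Definition y_slope (K u v : R) : R :=
  - (K * ((1 - K) * (u + v - u * v) + K) * / (den K u * den K v)).

Lemma y_field_difference (K u v : R) :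
  den K u <> 0 -> den K v <> 0 ->
  y_field K u - y_field K v = y_slope K u v * (u - v).
Proof.
intros Hu Hv; unfold y_field, y_slope.
replace ((1 - u) * K / den K u - 1 - ((1 - v) * K / den K v - 1))
  with (K * ((1 - u) * den K v - (1 - v) * den K u) / (den K u * den K v))
  by (field; auto).
replace ((1 - u) * den K v - (1 - v) * den K u)
  with (- ((1 - K) * (u + v - u * v) + K) * (u - v)) by (unfold den; ring).
field; auto.
Qed.

Lemma y_field_nonpos (K c : R) : 0 < K -> 0 <= c <= 1 -> y_field K c <= 0.
Proof.
intros HK Hc; assert (Hd := den_pos K c HK Hc).
unfold y_field; apply Rmult_le_reg_r with (den K c); auto.
replace (((1 - c) * K / den K c - 1) * den K c) with ((1 - c) * K - den K c)
  by (field; lra).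
assert (Hp : 0 <= K * (c * (1 - c))) by (repeat apply Rmult_le_pos; lra).
unfold den; nra.
Qed.

Lemma y_field_lower (K c : R) : 0 < K -> 0 <= c <= 1 -> -1 <= y_field K c.
Proof.
intros HK Hc; assert (Hd := den_pos K c HK Hc).
unfold y_field.
assert (0 <= (1 - c) * K / den K c); [|lra].
apply Rmult_le_pos; [nra | apply Rlt_le, Rinv_0_lt_compat; auto].
Qed.

Lemma y_slope_bound (K u v : R) :
  0 < K -> 0 <= u <= 1 -> 0 <= v <= 1 ->
  Rabs (y_slope K u v) <= K * (1 + K) * / (Rmin 1 K * Rmin 1 K).
Proof.
intros HK Hu Hv; unfold y_slope; rewrite Rabs_Ropp.
assert (Hm : 0 < Rmin 1 K) by (apply Rmin_pos; lra).
assert (H1 := den_lower K u HK Hu); assert (H2 := den_lower K v HK Hv).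
assert (Huv : 0 <= u + v - u * v <= 1) by nra.
assert (Hb : 0 <= (1 - K) * (u + v - u * v) + K <= 1 + K) by nra.
rewrite Rabs_pos_eq.
- apply Rmult_le_compat.
  + apply Rmult_le_pos; lra.
  + apply Rlt_le, Rinv_0_lt_compat; nra.
  + apply Rmult_le_compat_l; lra.
  + apply Rinv_le_contravar; nra.
- apply Rmult_le_pos; [apply Rmult_le_pos; lra|].
  apply Rlt_le, Rinv_0_lt_compat; nra.
Qed.

Lemma continuous_y_field (K y : R) : den K y <> 0 -> continuous (y_field K) y.
Proof.
intros Hd; apply (ex_derive_continuous (K := R_AbsRing) (V := R_NormedModule)).
unfold y_field, den in *; auto_derive; auto.
Qed.

(** Clamping the argument to [[0, 1]] makes the right-hand side bounded and
    Lipschitz.  The clamped solution decreases from [1], and it cannot cross [0]: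
    the right-hand side vanishes there, so below [0] the clamped equation reads
    [y' = 0].  Hence it never leaves [[0, 1]] and solves the original equation. *)
Lemma y_in_unit_interval_exists (K : R) : 0 < K ->
  exists y : R -> R, y 0 = 1 /\ (forall t, continuous y t) /\
    forall t, 0 <= t -> 0 <= y t <= 1 /\ is_derive y t (y_field K (y t)).
Proof.
intros HK.
assert (H01 : forall x, 0 <= clamp 0 1 x <= 1) by (intros; apply clamp_in; lra).
assert (HL : 0 < K * (1 + K) * / (Rmin 1 K * Rmin 1 K)).
{ assert (Hm : 0 < Rmin 1 K) by (apply Rmin_pos; lra).
  apply Rmult_lt_0_compat; [nra | apply Rinv_0_lt_compat; nra]. }
destruct (picard_global (fun _ x => y_field K (clamp 0 1 x)) 1
  (K * (1 + K) * / (Rmin 1 K * Rmin 1 K)) 1) as [y [Hy0 [Hyc Hy]]]; auto.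
- intros x Hx t.
  apply (continuous_comp (fun s => clamp 0 1 (x s)) (y_field K)).
  + apply (continuous_comp x (clamp 0 1)); auto; apply clamp_continuous.
  + apply continuous_y_field, Rgt_not_eq, den_pos; auto.
- intros _ x; apply Rabs_le_between; split.
  + now apply y_field_lower.
  + assert (H := y_field_nonpos K (clamp 0 1 x) HK (H01 x)); lra.
- intros _ u v; rewrite y_field_difference
    by (apply Rgt_not_eq, den_pos; auto).
  rewrite Rabs_mult; apply Rmult_le_compat; try apply Rabs_pos.
  + now apply y_slope_bound.
  + rewrite <- (Rmult_1_l (Rabs (u - v))); apply clamp_lipschitz.
- assert (Hcont : forall t, continuity_pt y t)
    by (intros t; apply continuity_pt_filterlim, Hyc).
  assert (Hmono : forall s t, 0 <= s <= t -> y t <= y s).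
  { intros s t Hst.
    assert (H := mean_growth (fun r => - y r)
      (fun r => - y_field K (clamp 0 1 (y r))) s t 0 (proj2 Hst)).
    simpl in H.
    assert (0 * (t - s) <= - y t - - y s); [apply H|lra].
    - intros r _; now apply (continuity_pt_opp y).
    - intros r Hr; refine (is_derive_opp y r _ _); apply Hy; lra.
    - intros r _; assert (Hf := y_field_nonpos K _ HK (H01 (y r))); lra. }
  assert (Hpos : forall t, 0 <= t -> 0 <= y t).
  { intros t Ht; apply Rnot_lt_le; intros Hneg.
    destruct (IVT_gen y 0 t 0) as [t0 [Ht0 Hyt0]].
    - intros s; apply Hcont.
    - rewrite Hy0, Rmin_right, Rmax_left by lra; lra.
    - rewrite Rmin_left, Rmax_right in Ht0 by lra.
      assert (H := mean_growth y (fun r => y_field K (clamp 0 1 (y r)))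
        t0 t 0 (proj2 Ht0)).
      assert (0 * (t - t0) <= y t - y t0); [apply H|lra]; auto.
      + intros r Hr; apply Hy; lra.
      + intros r Hr; assert (Hyr := Hmono t0 r (conj (proj1 Ht0) (proj1 Hr))).
        replace (clamp 0 1 (y r)) with 0
          by (unfold clamp; rewrite Rmin_right, Rmax_left; lra).
        unfold y_field, den; right; field; lra. }
  exists y; split; [|split]; auto; intros t Ht.
  assert (Hb : 0 <= y t <= 1).
  { split; [now apply Hpos|].
    rewrite <- Hy0; apply Hmono; lra. }
  split; auto.
  rewrite <- (clamp_id 0 1 (y t)) by auto; now apply Hy.
Qed.

(** As long as [y ^ 2 > K] one has [den <= 2 * y ^ 2], and the right-hand side
    [- y (y + K (1 - y)) / den] is at most [- 1 / 2].  Since [y] starts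
    from [1] and stays nonnegative, this cannot last beyond time [2], whatever
    [K]. *)
Lemma y_square_small (K : R) (y : R -> R) : 0 < K ->
  y 0 = 1 ->
  (forall t, 0 <= t -> 0 <= y t <= 1 /\ is_derive y t (y_field K (y t))) ->
  forall t, 2 <= t -> y t ^ 2 <= K.
Proof.
intros HK Hy0 Hy t Ht; apply Rnot_lt_le; intros Hbig.
assert (Hgrow : forall m s, 0 <= s <= t ->
    (forall r, s <= r <= t -> y_field K (y r) <= - m) -> m * (t - s) <= y s - y t).
{ intros m s Hs Hm.
  assert (m * (t - s) <= - y t - - y s); [|lra].
  apply (mean_growth (fun r => - y r) (fun r => - y_field K (y r)));
    [lra | | |].
  - intros r Hr; apply (continuity_pt_opp y).
    eapply is_derive_continuity_pt; apply Hy; lra.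
  - intros r Hr; refine (is_derive_opp y r _ _); apply Hy; lra.
  - intros r Hr; specialize (Hm r Hr); lra. }
assert (H := Hgrow (/ 2) 0).
assert (/ 2 * (t - 0) <= y 0 - y t).
{ apply H; [lra|]; intros r Hr.
  assert (Hr0 : 0 <= y r <= 1) by (apply Hy; lra).
  assert (Ht0 : 0 <= y t <= 1) by (apply Hy; lra).
  assert (Hrt : 0 * (t - r) <= y r - y t).
  { apply Hgrow; [lra|]; intros q Hq; rewrite Ropp_0.
    apply y_field_nonpos; auto; apply Hy; lra. }
  assert (Hd := den_pos K (y r) HK Hr0).
  assert (Hsq : y t ^ 2 <= y r ^ 2) by (apply pow_incr; lra).
  apply Rmult_le_reg_r with (den K (y r)); auto.
  unfold y_field.
  replace (((1 - y r) * K / den K (y r) - 1) * den K (y r))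
    with ((1 - y r) * K - den K (y r)) by (field; lra).
  unfold den.
  (* [y' <= - 1 / 2] reads [K * (1 - y) ^ 2 <= y ^ 2] once cleared of
     denominators. *)
  assert (Hone : K * (1 - y r) ^ 2 <= K * 1).
  { apply Rmult_le_compat_l; [lra|].
    rewrite <- (pow1 2); apply pow_incr; lra. }
  nra. }
assert (Ht0 : 0 <= y t <= 1) by (apply Hy; lra).
assert (y t = 0) by lra.
rewrite H1 in Hbig; lra.
Qed.

(** * Blow-up of the Riccati equation *)

(** The right-hand side of the equation for [x] that [z = tan x] transforms into
    [z' = a (z ^ 2 - 1) + 1], namely [a sin ^ 2 x + (1 - a) cos ^ 2 x], written
    with the double angle to make its sign and Lipschitz bounds visible. *)
Definition angle_rate (a x : R) : R := / 2 + (/ 2 - a) * cos (2 * x).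

Lemma cos_double_nonpos (x : R) : PI / 4 <= x <= PI / 2 -> -1 <= cos (2 * x) <= 0.
Proof.
intros Hx; split; [apply COS_bound|].
apply cos_le_0; assert (H := PI_RGT_0); lra.
Qed.

Lemma cos_lipschitz (u v : R) : Rabs (cos u - cos v) <= 1 * Rabs (u - v).
Proof.
apply (bounded_variation cos (fun t => - sin t)); intros t _; split.
- apply is_derive_Reals, derivable_pt_lim_cos.
- rewrite Rabs_Ropp; apply Rabs_le_between, SIN_bound.
Qed.

(** On [[PI / 4, PI / 2]] the cosine of the double angle is nonpositive, so the
    rate is positive, and at least [1 / 2] once [a >= 1 / 2].  After time [2] the
    remaining distance to [PI / 2], at most [PI / 4 <= 1], is covered in time [2];
    the bound [5] leaves a margin for strict inequality. *)
Lemma angle_reaches_PI2 (a : R -> R) (A : R) :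
  (forall t, continuous a t) ->
  (forall t, 0 < a t <= A) ->
  (forall t, 2 <= t -> / 2 <= a t) ->
  exists (th : R -> R) (tc : R),
    0 < tc < 5 /\ th 0 = PI / 4 /\ th tc = PI / 2 /\
    (forall t, continuous th t) /\
    forall t, 0 <= t < tc ->
      PI / 4 <= th t < PI / 2 /\ is_derive th t (angle_rate (a t) (th t)).
Proof.
intros Hac Ha Ha2.
assert (HPI := PI_RGT_0); assert (HPI4 := PI_4).
set (cl := clamp (PI / 4) (PI / 2)).
assert (Hcl : forall x, -1 <= cos (2 * cl x) <= 0).
{ intros x; apply cos_double_nonpos, clamp_in; lra. }
assert (HA : 0 < A) by (specialize (Ha 0); lra).
assert (Habs : forall t, Rabs (/ 2 - a t) <= / 2 + A).
{ intros t; specialize (Ha t); apply Rabs_le_between; lra. }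
destruct (picard_global (fun t x => angle_rate (a t) (cl x)) (PI / 4)
  ((/ 2 + A) * 2) (1 + A)) as [th [Hth0 [Hthc Hth]]].
- lra.
- intros x Hx t; unfold angle_rate.
  apply (continuous_plus (fun _ => / 2)); [apply continuous_const|].
  apply (continuous_mult (fun s => / 2 - a s) (fun s => cos (2 * cl (x s)))).
  + apply (continuous_minus (fun _ => / 2) a); auto; apply continuous_const.
  + apply (continuous_comp (fun s => 2 * cl (x s)) cos).
    * apply (continuous_mult (fun _ => 2)); [apply continuous_const|].
      apply (continuous_comp x cl); auto; apply clamp_continuous.
    * apply continuous_cos.
- intros t x; unfold angle_rate; specialize (Hcl x); specialize (Ha t).
  apply Rabs_le_between; nra.
- intros t u v; unfold angle_rate.
  replace (/ 2 + (/ 2 - a t) * cos (2 * cl u)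
      - (/ 2 + (/ 2 - a t) * cos (2 * cl v)))
    with ((/ 2 - a t) * (cos (2 * cl u) - cos (2 * cl v))) by ring.
  rewrite Rabs_mult, Rmult_assoc.
  apply Rmult_le_compat; try apply Rabs_pos; auto.
  apply Rle_trans with (1 := cos_lipschitz _ _).
  rewrite <- Rmult_minus_distr_l, Rabs_mult, (Rabs_pos_eq 2) by lra.
  assert (H := clamp_lipschitz (PI / 4) (PI / 2) u v); fold cl in H; lra.
- assert (Hcont : forall t, continuity_pt th t)
    by (intros t; apply continuity_pt_filterlim, Hthc).
  assert (Hratepos : forall t x, 0 < angle_rate (a t) (cl x)).
  { intros t x; unfold angle_rate; specialize (Hcl x); specialize (Ha t); nra. }
  assert (Hincr : forall s t, 0 <= s < t -> th s < th t).
  { intros s t Hst.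
    destruct (MVT_gen th s t (fun r => angle_rate (a r) (cl (th r))))
      as [c [Hc1 Hc2]]; rewrite ?Rmin_left, ?Rmax_right in * by lra; auto.
    - intros r Hr; apply Hth; lra.
    - assert (H := Hratepos c (th c)); nra. }
  assert (H5 : PI / 2 < th 5).
  { assert (H02 := Hincr 0 2 ltac:(lra)).
    assert (/ 2 * (5 - 2) <= th 5 - th 2); [|lra].
    apply (mean_growth th (fun r => angle_rate (a r) (cl (th r)))); auto.
    - lra.
    - intros t Ht; apply Hth; lra.
    - intros t Ht; unfold angle_rate; specialize (Hcl (th t)).
      specialize (Ha2 t (proj1 Ht)); nra. }
  destruct (IVT_gen th 0 5 (PI / 2)) as [tc [Htc Hthtc]].
  + intros s; apply Hcont.
  + rewrite Hth0, Rmin_left, Rmax_right by lra; lra.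
  + rewrite Rmin_left, Rmax_right in Htc by lra.
    assert (Htc0 : tc <> 0) by (intros E; rewrite E, Hth0 in Hthtc; lra).
    assert (Htc5 : tc <> 5) by (intros E; rewrite E in Hthtc; lra).
    exists th, tc; split; [lra|].
    split; [exact Hth0 | split; [exact Hthtc | split; [exact Hthc|]]].
    intros t Ht.
    assert (Hb : PI / 4 <= th t < PI / 2).
    { split; [|rewrite <- Hthtc; apply Hincr; lra].
      destruct (Req_dec t 0) as [E|E]; [rewrite E, Hth0; lra|].
      rewrite <- Hth0; apply Rlt_le, Hincr; lra. }
    split; auto.
    rewrite <- (clamp_id (PI / 4) (PI / 2) (th t)) by lra.
    apply Hth; lra.
Qed.

Lemma tan_angle_rate (a x : R) : cos x <> 0 ->
  (tan x ^ 2 + 1) * angle_rate a x = a * (tan x ^ 2 - 1) + 1.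
Proof.
intros Hc; unfold angle_rate, tan; rewrite cos_2a_cos.
assert (Hs : sin x ^ 2 = 1 - cos x ^ 2)
  by (assert (H := sin2_cos2 x); unfold Rsqr in H; lra).
unfold Rdiv; rewrite !Rpow_mult_distr, Hs; field; auto.
Qed.

(** [M < tan x] amounts to [0 < sin x - M * cos x] for [0 < x < PI / 2], and the
    right-hand expression is continuous with value [1] at [PI / 2]. *)
Lemma tan_blowup (th : R -> R) (t0 : R) :
  continuous th t0 -> th t0 = PI / 2 ->
  at_left t0 (fun t => 0 < th t < PI / 2) ->
  filterlim (fun t => tan (th t)) (at_left t0) (Rbar_locally p_infty).
Proof.
intros Hc H0 Hleft P [M HM].
assert (Hnear : locally t0 (fun t => 0 < sin (th t) - M * cos (th t))).
{ assert (Hf : continuous (fun t => sin (th t) - M * cos (th t)) t0).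
  { apply (continuous_minus (fun t => sin (th t))).
    - apply (continuous_comp th sin); auto; apply continuous_sin.
    - apply (continuous_mult (fun _ => M)); [apply continuous_const|].
      apply (continuous_comp th cos); auto; apply continuous_cos. }
  apply Hf; rewrite H0, sin_PI2, cos_PI2.
  apply (open_gt 0); lra. }
unfold filtermap; generalize Hleft Hnear; unfold at_left, within.
intros H1 H2; generalize (filter_and _ _ H1 H2); apply filter_imp.
intros t [Ht1 Ht2] Hlt; specialize (Ht1 Hlt); apply HM.
assert (Hcos : 0 < cos (th t)) by (apply cos_gt_0; lra).
unfold tan; apply Rmult_lt_reg_r with (cos (th t)); auto.
replace (sin (th t) / cos (th t) * cos (th t)) with (sin (th t))
  by (field; lra); lra.
Qed.

Lemma riccati_blowup (a : R -> R) (A : R) :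
  (forall t, continuous a t) ->
  (forall t, 0 < a t <= A) ->
  (forall t, 2 <= t -> / 2 <= a t) ->
  exists (z : R -> R) (tc : R),
    0 < tc < 5 /\ z 0 = 1 /\
    (forall t, 0 <= t < tc -> is_derive z t (a t * (z t ^ 2 - 1) + 1)) /\
    filterlim z (at_left tc) (Rbar_locally p_infty).
Proof.
intros Hac Ha Ha2.
destruct (angle_reaches_PI2 a A Hac Ha Ha2)
  as [th [tc [Htc [Hth0 [Hthtc [Hthc Hth]]]]]].
assert (HPI := PI_RGT_0).
exists (fun t => tan (th t)), tc; split; [|split; [|split]]; auto.
- rewrite Hth0; apply tan_PI4.
- intros t Ht; destruct (Hth t Ht) as [Hb Hd].
  assert (Hcos : cos (th t) <> 0) by (apply Rgt_not_eq, cos_gt_0; lra).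
  rewrite <- tan_angle_rate, Rmult_comm by auto.
  refine (is_derive_comp tan th t _ _ _ Hd).
  now apply is_derive_tan.
- apply tan_blowup; auto.
  exists (mkposreal tc (proj1 Htc)); intros t Ht Hlt.
  apply Rabs_lt_between in Ht; simpl in Ht.
  unfold minus, plus, opp in Ht; simpl in Ht.
  assert (H := Hth t ltac:(lra)); lra.
Qed.

(** * The two initial value problems *)

Lemma y_slope_continuous (K : R) (u v : R -> R) (t : R) :
  continuity_pt u t -> continuity_pt v t ->
  den K (u t) <> 0 -> den K (v t) <> 0 ->
  continuity_pt (fun s => y_slope K (u s) (v s)) t.
Proof.
intros Hu Hv Hdu Hdv; unfold y_slope, den in *; simpl in *.
repeat match goal with
| |- continuity_pt (fun s => ?c) t =>
    apply continuity_pt_const; intros ? ?; reflexivity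
| |- continuity_pt (fun s => - @?f s) t => apply (continuity_pt_opp f)
| |- continuity_pt (fun s => / @?f s) t =>
    apply (continuity_pt_inv f); [|now apply Rmult_integral_contrapositive]
| |- continuity_pt (fun s => @?f s + @?g s) t => apply (continuity_pt_plus f g)
| |- continuity_pt (fun s => @?f s - @?g s) t => apply (continuity_pt_minus f g)
| |- continuity_pt (fun s => @?f s * @?g s) t => apply (continuity_pt_mult f g)
end; assumption.
Qed.

Lemma is_y_exists (K : R) : 0 < K ->
  exists y : R -> R,
    is_y K p_infty y /\ (forall t, continuous y t) /\
    (forall t, 0 <= t -> 0 <= y t <= 1) /\
    (forall t, 2 <= t -> y t ^ 2 <= K).
Proof.
intros HK.
destruct (y_in_unit_interval_exists K HK) as [y [Hy0 [Hyc Hy]]].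
assert (Hysol : ivp_solution (fun _ y => den K y <> 0) (fun _ => y_field K) 1
    p_infty y).
{ apply ivp_solution_of_derive; auto.
  intros t [Ht _]; destruct (Hy t Ht) as [Hb Hd].
  split; auto; now apply Rgt_not_eq, den_pos. }
exists y; split; [split; [exact I | split; [exact Hysol|]] | split; [|split]].
- intros S w Hw; split; [now destruct S|].
  intros t Ht.
  apply (ivp_unique _ _ _ _ _ w y (fun s => y_slope K (w s) (y s)) Hw Hysol);
    auto.
  + intros s Hs Hs'; apply (y_field_difference K);
      [apply Hw | apply Hysol]; auto.
  + intros s Hs Hs'.
    apply (y_slope_continuous K (fun r => w (Rmax 0 r)) (fun r => y (Rmax 0 r)));
      [eapply ivp_continuous; eauto | eapply ivp_continuous; eauto | |];
      simpl; rewrite Rmax_right by apply Hs; [apply Hw | apply Hysol]; auto.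
  + split; [apply Ht | exact I].
- exact Hyc.
- intros t Ht; now apply Hy.
- now apply y_square_small.
Qed.

(** Two solutions of the Riccati equation satisfy
    [(w - z)' = a (w + z) (w - z)], which makes the solution [z] of
    [riccati_blowup] unique; its divergence at [tc] makes it maximal. *)
Lemma is_z_exists (K : R) (y : R -> R) : 0 < K ->
  (forall t, continuous y t) ->
  (forall t, 0 <= t -> 0 <= y t <= 1) ->
  (forall t, 2 <= t -> y t ^ 2 <= K) ->
  exists (z : R -> R) (tc : R),
    0 < tc < 5 /\ is_z K y (Finite tc) z /\
    continuous_on (fun t => 0 <= t < tc) z /\
    filterlim z (at_left tc) (Rbar_locally p_infty).
Proof.
intros HK Hyc Hy01 Hysmall.
(* The clamp changes nothing for [t >= 0]; it makes the coefficient continuous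
   and bounded for negative times too. *)
set (a := fun t => K / den K (clamp 0 1 (y t))).
assert (Hcl : forall t, 0 <= clamp 0 1 (y t) <= 1)
  by (intros; apply clamp_in; lra).
assert (Haeq : forall t, 0 <= t -> a t = K / den K (y t)).
{ intros t Ht; unfold a; rewrite clamp_id; auto. }
assert (Hac : forall t, continuous a t).
{ intros t; unfold a.
  apply (continuous_comp (fun t => clamp 0 1 (y t)) (fun c => K / den K c)).
  - apply (continuous_comp y (clamp 0 1)); auto; apply clamp_continuous.
  - apply (ex_derive_continuous (K := R_AbsRing) (V := R_NormedModule)).
    assert (Hd := den_pos K _ HK (Hcl t)).
    unfold den in *; auto_derive; simpl in *; lra. }
destruct (riccati_blowup a (K * / Rmin 1 K)) as [z [tc [Htc [Hz0 [Hz Hzlim]]]]].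
- exact Hac.
- intros t; assert (Hd := den_pos K _ HK (Hcl t)); split.
  + now apply Rdiv_lt_0_compat.
  + apply Rmult_le_compat_l; [lra|].
    apply Rinv_le_contravar; [apply Rmin_pos; lra | now apply den_lower].
- intros t Ht; rewrite Haeq by lra.
  assert (Hb : 0 <= y t <= 1) by (apply Hy01; lra).
  assert (Hsmall := Hysmall t Ht).
  assert (Hd := den_pos K _ HK Hb).
  apply Rmult_le_reg_r with (den K (y t)); auto.
  replace (K / den K (y t) * den K (y t)) with K by (field; lra).
  (* [y ^ 2 <= K] and [(1 - y ^ 2) * K <= K] give [den <= 2 * K]. *)
  unfold den; nra.
- set (field_z := fun t z => K / den K (y t) * (z ^ 2 - 1) + 1).
  assert (Hzsol : ivp_solution (fun t _ => den K (y t) <> 0) field_z 1 tc z).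
  { apply ivp_solution_of_derive; auto.
    intros t [Ht Htlt]; simpl in Htlt; split.
    - apply Rgt_not_eq, den_pos; auto.
    - unfold field_z; rewrite <- Haeq by auto; apply Hz; lra. }
  assert (Huniq : forall S w,
      ivp_solution (fun t _ => den K (y t) <> 0) field_z 1 S w ->
      forall t, Ico S t -> Ico tc t -> w t = z t).
  { intros S w Hw.
    apply (ivp_unique _ _ _ _ _ w z (fun s => a s * (w s + z s)) Hw Hzsol).
    - intros t [Ht _] _; unfold field_z; rewrite <- Haeq by auto; ring.
    - intros t Ht Ht'.
      apply (continuity_pt_mult (fun s => a (Rmax 0 s))
        (fun s => w (Rmax 0 s) + z (Rmax 0 s))).
      + apply (continuity_pt_comp (Rmax 0) a).
        * apply continuity_pt_filterlim, (lipschitz_continuous (Rmax 0) 1).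
          intros r s; rewrite Rmult_1_l; apply Rmax_lipschitz.
        * apply continuity_pt_filterlim, Hac.
      + apply (continuity_pt_plus (fun s => w (Rmax 0 s))
          (fun s => z (Rmax 0 s))); eapply ivp_continuous; eauto. }
  exists z, tc; split; [|split; [|split]]; auto.
  + split; [apply Htc | split; [exact Hzsol|]].
    intros S w Hw.
    assert (HS : Rbar_le S tc).
    { apply (blowup_maximal S tc w z); auto; [apply Htc|..].
      - intros t Ht; eapply ivp_continuous; eauto.
      - now apply (Huniq S w Hw). }
    split; auto; intros t [Ht HtS]; apply (Huniq S w Hw); split; auto.
    now apply Rbar_lt_le_trans with S.
  + intros t Ht.
    apply (filterlim_filter_le_1 (F := locally t)); [apply filter_le_within|].
    apply (ex_derive_continuous (K := R_AbsRing) (V := R_NormedModule)).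
    eexists; now apply Hz.
Qed.

Theorem proposition1p2 :
  exists (y z : R -> R -> R) (tc : R -> R),
    (forall K : R, 0 < K ->
       is_y K p_infty (y K) /\
       0 < tc K /\
       is_z K (y K) (Finite (tc K)) (z K) /\
       continuous_on (fun t => 0 <= t < tc K) (z K) /\
       filterlim (z K) (at_left (tc K)) (Rbar_locally p_infty)) /\
    (exists M : R, 0 < M /\ forall K : R, 0 < K -> 0 < tc K < M).
Proof.
destruct (functional_choice (fun K (s : (R -> R) * (R -> R) * R) => 0 < K ->
    is_y K p_infty (fst (fst s)) /\ 0 < snd s < 5 /\
    is_z K (fst (fst s)) (Finite (snd s)) (snd (fst s)) /\
    continuous_on (fun t => 0 <= t < snd s) (snd (fst s)) /\
    filterlim (snd (fst s)) (at_left (snd s)) (Rbar_locally p_infty)))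
  as [sol Hsol].
{ intros K; destruct (Rlt_dec 0 K) as [HK|HK].
  - destruct (is_y_exists K HK) as [y [Hy [Hyc [Hy01 Hysmall]]]].
    destruct (is_z_exists K y HK Hyc Hy01 Hysmall) as [z [tc [Htc Hz]]].
    exists (y, z, tc); intros _; exact (conj Hy (conj Htc Hz)).
  - exists (fun _ => 0, fun _ => 0, 0); intros; contradiction. }
exists (fun K => fst (fst (sol K))), (fun K => snd (fst (sol K))),
  (fun K => snd (sol K)).
split.
- intros K HK; destruct (Hsol K HK) as [Hy [[Htc _] Hz]].
  exact (conj Hy (conj Htc Hz)).
- exists 5; split; [lra|]; intros K HK; now apply Hsol.
Qed.
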